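(* Let the expected cocoercivity assumption hold: for all $x\in\mathbb{R}^d$, with $x^*=\mathrm{proj}_{X^*}(x)$, $$\mathbb{E}_{\xi\sim\mathcal{D}}\|F_\xi(x)-F_\xi(x^* )\|^2\le\ell_{\mathcal{D}}\langle F(x)-F(x^* ),x-x^*\rangle.$$ Then SGDA-AS satisfies the key parametric assumption with $A=\ell_{\mathcal{D}}$, $B=0$, $\sigma_k^2\equiv0$, $C=0$, $\rho=1$, $D_2=0$, and $$D_1=2\sigma_*^2:=2\max_{x^*\in X^*}\mathbb{E}_{\xi\sim\mathcal{D}}\|F_\xi(x^* )-F(x^* )\|^2.$$
   Context: Norms and inner products on $\mathbb{R}^d$ are Euclidean. $F:\mathbb{R}^d\to\mathbb{R}^d$ is an operator with $F(x)=\mathbb{E}_{\xi\sim\mathcal{D}}[F_\xi(x)]$ for all $x$, where $\mathcal{D}$ is a distribution; $R:\mathbb{R}^d\to\mathbb{R}\cup\{+\infty\}$ is a proper lower semicontinuous convex function. $X^*$ is the (nonempty) set of solutions of the regularized variational inequality: find $x^*\in\mathbb{R}^d$ with $\langle F(x^* ),x-x^*\rangle+R(x)-R(x^* )\ge0$ for all $x\in\mathbb{R}^d$. $\mathrm{proj}_{X^*}(x)=\arg\min_{y\in X^*}\|y-x\|$ (taken to be well defined). The quantity $\sigma_*^2$ is finite. (The main special case is $F=\frac1n\sum_{i=1}^nF_i$, $F_\xi(x)=\frac1n\sum_{i=1}^n\xi_iF_i(x)$, with $\xi=(\xi_1,\dots,\xi_n)\sim\mathcal{D}$ a random vector in $\mathbb{R}^n$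 with $\mathbb{E}[\xi_i]=1$ for all $i$.) SGDA-AS: at each iteration sample $\xi^k\sim\mathcal{D}$ independently of previous iterations, set $g^k=F_{\xi^k}(x^k)$ and $x^{k+1}=\mathrm{prox}_{\gamma R}(x^k-\gamma g^k)$, where $\gamma>0$ and $\mathrm{prox}_{\gamma R}(x)=\arg\min_{y}\{R(y)+\|y-x\|^2/(2\gamma)\}$. Put $x^{*,k}=\mathrm{proj}_{X^*}(x^k)$ and $g^{*,k}=F(x^{*,k})$. $\mathbb{E}_k[\cdot]$ is the expectation with respect to the randomness at iteration $k$, i.e. conditional on everything generated before iteration $k$. Key parametric assumption (with constants $A,B,C,D_1,D_2\ge0$, $\rho\in(0,1]$ and nonnegative variables $\sigma_k$): for all $k\ge0$, $\mathbb{E}_k[g^k]=F(x^k)$ and $$\mathbb{E}_k\|g^k-g^{*,k}\|^2\le2A\langle F(x^k)-g^{*,k},x^k-x^{*,k}\rangle+B\sigma_k^2+D_1,$$ $$\mathbb{E}_k[\sigma_{k+1}^2]\le2C\langle F(x^k)-g^{*,k},x^k-x^{*,k}\rangle+(1-\rho)\sigma_k^2+D_2.$$ *)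

(* Defs.v *)
From HB Require Import structures.
From mathcomp Require Import all_boot all_order all_algebra.
From mathcomp Require Import all_classical all_reals all_analysis.
From mathcomp Require Import measurable_realfun.

Set Implicit Arguments.
Unset Strict Implicit.
Unset Printing Implicit Defensive.

Import Order.TTheory GRing.Theory Num.Theory.
Import numFieldNormedType.Exports.

Local Open Scope classical_set_scope.
Local Open Scope ring_scope.

(* The norm [`|x|] that the library puts on matrices is the sup norm, so the
   Euclidean structure of R^d is introduced explicitly; both norms induce the
   same topology. *)
Definition dot (R : realType) (d : nat) (u v : 'rV[R]_d) : R :=
  \sum_(i < d) u ord0 i * v ord0 i.

Definition enorm (R : realType) (d : nat) (u : 'rV[R]_d) : R :=
  Num.sqrt (dot u u).

(* R^d with its Borel sigma-algebra. *)
Notation borel_rV R d := (g_sigma_algebraType (@open 'rV[R]_d)).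

Definition argmin (R : realType) (T : Type) (S : set T) (f : T -> \bar R) :
    set T :=
  [set y | S y /\ forall z, S z -> (f y <= f z)%E].

Definition proj_set (R : realType) (d : nat) (S : set 'rV[R]_d)
    (x : 'rV[R]_d) : set 'rV[R]_d :=
  argmin S (fun y => (enorm (y - x))%:E).

(* Meaningful when [proj_set S x] is a singleton. *)
Definition proj (R : realType) (d : nat) (S : set 'rV[R]_d) (x : 'rV[R]_d) :
    'rV[R]_d :=
  xget 0 (proj_set S x).

(* For r proper, lower semicontinuous and convex and gamma > 0 the minimizer
   exists and is unique. *)
Definition prox (R : realType) (d : nat) (gamma : R) (r : 'rV[R]_d -> \bar R)
    (x : 'rV[R]_d) : 'rV[R]_d :=
  xget 0 (argmin setT
    (fun y => (r y + (enorm (y - x) ^+ 2 / (2 * gamma))%:E)%E)).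

Definition proper_fun (R : realType) (T : Type) (r : T -> \bar R) : Prop :=
  (forall x, (-oo < r x)%E) /\ (exists x, (r x < +oo)%E).

(* Convexity for functions with values in R U {+oo}; [0 * +oo = 0] in
   [\bar R]. *)
Definition econvex (R : realType) (d : nat) (r : 'rV[R]_d -> \bar R) : Prop :=
  forall (x y : 'rV[R]_d) (t : R), 0 <= t <= 1 ->
    (r (t *: x + (1 - t) *: y)%R <= t%:E * r x + (1 - t)%:E * r y)%E.

(* In [\bar R], [+oo - +oo = -oo]: for r proper, a solution has r xs < +oo. *)
Definition VI_solutions (R : realType) (d : nat) (F : 'rV[R]_d -> 'rV[R]_d)
    (r : 'rV[R]_d -> \bar R) : set 'rV[R]_d :=
  [set xs | forall x, (0 <= (dot (F xs) (x - xs)%R)%:E + r x - r xs)%E].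

Section Stochastic.
Context (R : realType) (d : nat).
Context (dX : measure_display) (Xi : measurableType dX) (D : probability Xi R).
Context (Fxi : Xi -> 'rV[R]_d -> 'rV[R]_d) (F : 'rV[R]_d -> 'rV[R]_d).

Definition stochastic_representation : Prop :=
  measurable_fun setT
    (fun zx : Xi * borel_rV R d => Fxi zx.1 zx.2 : borel_rV R d) /\
  forall x i,
    D.-integrable setT (fun z => (Fxi z x ord0 i)%:E) /\
    ('E_D[fun z => Fxi z x ord0 i] = (F x ord0 i)%:E)%E.

Definition expected_cocoercivity (S : set 'rV[R]_d) (ell : R) : Prop :=
  forall x, let xs := proj S x in
    ('E_D[fun z => (enorm (Fxi z x - Fxi z xs) ^+ 2)%R]
      <= (ell * dot (F x - F xs) (x - xs))%R%:E)%E.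

(* The supremum is the maximum whenever the latter exists. *)
Definition sigma_star2 (S : set 'rV[R]_d) : \bar R :=
  ereal_sup [set 'E_D[fun z => (enorm (Fxi z xs - F xs) ^+ 2)%R]%E | xs in S].

End Stochastic.

Section ConditionalExpectation.
Context (R : realType) (dO : measure_display) (Om : measurableType dO).
Context (P : probability Om R).
Local Open Scope ereal_scope.

Definition sub_measurable (G : set (set Om)) (Y : Om -> \bar R) : Prop :=
  forall B : set (\bar R), measurable B -> G (Y @^-1` B).

Definition is_condexp_ge0 (G : set (set Om)) (X Y : Om -> \bar R) : Prop :=
  [/\ sub_measurable G Y,
      forall w, 0 <= Y w &
      forall A, G A -> \int[P]_(w in A) Y w = \int[P]_(w in A) X w].

(* Y is a version of E[X | G], in the generalized sense
   E[X | G] = E[X^+ | G] - E[X^- | G], which does not require X to be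
   integrable, only that almost surely the two terms are not both infinite. *)
Definition is_condexp (G : set (set Om)) (X Y : Om -> \bar R) : Prop :=
  [/\ measurable_fun setT X,
      sub_measurable G Y &
      exists Yp Yn : Om -> \bar R,
        [/\ is_condexp_ge0 G X^\+ Yp,
            is_condexp_ge0 G X^\- Yn &
            {ae P, forall w, (Yp w < +oo \/ Yn w < +oo) /\
                             Y w = Yp w - Yn w}]].

(* E[X | G] <= b almost surely; versions of E[X | G] agree almost surely, so
   the choice of Y is immaterial. *)
Definition condexp_le (G : set (set Om)) (X b : Om -> R) : Prop :=
  exists2 Y : Om -> \bar R,
    is_condexp G (EFin \o X) Y & {ae P, forall w, Y w <= (b w)%:E}.

End ConditionalExpectation.

Section Algorithm.
Context (R : realType) (d : nat).
Context (dX : measure_display) (Xi : measurableType dX).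
Context (dO : measure_display) (Om : measurableType dO) (P : probability Om R).

(* Sigma-algebra of everything generated before iteration k: the samples
   xi^0, ..., xi^(k-1) and the iterates x^0, ..., x^k. *)
Definition history (xi : nat -> {RV P >-> Xi})
    (x : nat -> {RV P >-> borel_rV R d}) (k : nat) : set (set Om) :=
  <<s (\bigcup_(j in [set j | (j < k)%N]) g_sigma_algebra_preimage (xi j)) `|`
      (\bigcup_(j in [set j | (j <= k)%N]) g_sigma_algebra_preimage (x j)) >>.

Definition sgda_as (D : probability Xi R) (Fxi : Xi -> 'rV[R]_d -> 'rV[R]_d)
    (r : 'rV[R]_d -> \bar R) (gamma : R) (xi : nat -> {RV P >-> Xi})
    (x : nat -> {RV P >-> borel_rV R d}) : Prop :=
  [/\ forall k B, measurable B -> P (xi k @^-1` B) = D B,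
      forall k A B, history xi x k A -> measurable B ->
        P (A `&` xi k @^-1` B) = (P A * P (xi k @^-1` B))%E &
      forall k w, x k.+1 w =
        prox gamma r ((x k w : 'rV[R]_d) - gamma *: Fxi (xi k w) (x k w))].

(* G k stands for the information available before iteration k, S for the
   solution set, g k for the stochastic estimator used at iteration k. *)
Definition key_parametric_assumption (G : nat -> set (set Om))
    (F : 'rV[R]_d -> 'rV[R]_d) (S : set 'rV[R]_d)
    (x g : nat -> Om -> 'rV[R]_d) (sigma : nat -> Om -> R)
    (A B C rho D1 D2 : R) : Prop :=
  [/\ [/\ 0 <= A, 0 <= B, 0 <= C, 0 <= D1 & 0 <= D2],
      0 < rho <= 1,
      forall k w, 0 <= sigma k w &
      forall k,
        let xs := fun w => proj S (x k w) in
        let gs := fun w => F (xs w) in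
        let gap := fun w => dot (F (x k w) - gs w) (x k w - xs w) in
        [/\ forall i, is_condexp P (G k)
              (fun w => (g k w ord0 i)%:E) (fun w => (F (x k w) ord0 i)%:E),
            condexp_le P (G k) (fun w => enorm (g k w - gs w) ^+ 2)
              (fun w => 2 * A * gap w + B * sigma k w ^+ 2 + D1) &
            condexp_le P (G k) (fun w => sigma k.+1 w ^+ 2)
              (fun w => 2 * C * gap w + (1 - rho) * sigma k w ^+ 2 + D2)]].

End Algorithm.

(* Main.v *)
Require Import Defs.
From HB Require Import structures.
From mathcomp Require Import all_boot all_order all_algebra.
From mathcomp Require Import all_classical all_reals all_analysis.
From mathcomp Require Import measurable_realfun ring lra.

Set Implicit Arguments.
Unset Strict Implicit.
Unset Printing Implicit Defensive.

Import Order.TTheory GRing.Theory Num.Theory.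
Import numFieldNormedType.Exports.
Local Open Scope classical_set_scope.
Local Open Scope ring_scope.

(* Freeze the iterate. Given the past, [xi^k] is a fresh sample of [D], so for
   nonnegative [h] a version of [E_k[h (xi^k, x^k)]] is obtained by integrating
   [h (-, x^k)] against [D] (Fubini-Tonelli). The unbiasedness is then the
   hypothesis on [F], and the second moment bound follows pointwise from
   [|a + b|^2 <= 2|a|^2 + 2|b|^2] with [a = Fxi x - Fxi xs] and
   [b = Fxi xs - F xs], cocoercivity bounding the first term and [sigma_*^2] the
   second. Measurability of [F (proj x)] holds because unique nearest points
   force the set to be closed and the projection to be continuous. *)

(** * Euclidean norm and the topology it induces *)

Lemma dot_ge0 (R : realType) d (u : 'rV[R]_d) : 0 <= dot u u.
Proof. by apply: sumr_ge0 => i _; rewrite -expr2 sqr_ge0. Qed.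

Lemma sqr_enorm (R : realType) d (u : 'rV[R]_d) : enorm u ^+ 2 = dot u u.
Proof. by rewrite sqr_sqrtr// dot_ge0. Qed.

Lemma enorm_ge0 (R : realType) d (u : 'rV[R]_d) : 0 <= enorm u.
Proof. exact: sqrtr_ge0. Qed.

Lemma enorm0 (R : realType) d : enorm (0 : 'rV[R]_d) = 0.
Proof. by rewrite /enorm /dot big1 ?sqrtr0// => i _; rewrite mxE mul0r. Qed.

Lemma ler_coord_enorm (R : realType) d (u : 'rV[R]_d) i :
  `|u ord0 i| <= enorm u.
Proof.
rewrite -sqrtr_sqr ler_wsqrtr// /dot (bigD1 i)//= -expr2 lerDl.
by apply: sumr_ge0 => j _; rewrite -expr2 sqr_ge0.
Qed.

Lemma enormN (R : realType) d (u : 'rV[R]_d) : enorm (- u) = enorm u.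
Proof. by congr Num.sqrt; apply: eq_bigr => i _; rewrite mxE mulrNN. Qed.

Lemma enorm_distC (R : realType) d (u v : 'rV[R]_d) :
  enorm (u - v) = enorm (v - u).
Proof. by rewrite -opprB enormN. Qed.

Lemma dotDD (R : realType) d (u v : 'rV[R]_d) :
  dot (u + v) (u + v) = dot u u + 2 * dot u v + dot v v.
Proof.
rewrite /dot mulr_sumr -!big_split/=; apply: eq_bigr => i _.
by rewrite mxE; ring.
Qed.

(** Cauchy-Schwarz: expand [|a u - b v|^2 >= 0] with [a = |v|] and [b = |u|], then divide by
    [|u| |v|]. A vector of norm zero has zero coordinates and is treated apart. *)
Lemma dot_le_enorm (R : realType) d (u v : 'rV[R]_d) :
  dot u v <= enorm u * enorm v.
Proof.
have key (a b : R) :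
    2 * (a * b) * dot u v <= a ^+ 2 * dot u u + b ^+ 2 * dot v v.
  rewrite -subr_ge0; have -> : a ^+ 2 * dot u u + b ^+ 2 * dot v v
      - 2 * (a * b) * dot u v = dot (a *: u - b *: v) (a *: u - b *: v).
    rewrite /dot !mulr_sumr -sumrN -!big_split/=; apply: eq_bigr => i _.
    by rewrite !mxE; ring.
  exact: dot_ge0.
have [/eqP u0|u_neq0] := boolP (enorm u == 0).
  rewrite u0 mul0r /dot big1// => i _; have := ler_coord_enorm u i.
  by rewrite u0 normr_le0 => /eqP ->; rewrite mul0r.
have [/eqP v0|v_neq0] := boolP (enorm v == 0).
  rewrite v0 mulr0 /dot big1// => i _; have := ler_coord_enorm v i.
  by rewrite v0 normr_le0 => /eqP ->; rewrite mulr0.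
have uv_gt0 : 0 < enorm u * enorm v.
  by rewrite mulr_gt0// lt_neqAle eq_sym ?u_neq0 ?v_neq0 enorm_ge0.
have := key (enorm v) (enorm u); rewrite -!sqr_enorm => uv.
rewrite -(ler_pM2l uv_gt0); lra.
Qed.

Lemma enormD (R : realType) d (u v : 'rV[R]_d) :
  enorm (u + v) <= enorm u + enorm v.
Proof.
rewrite -ler_sqr ?nnegrE ?addr_ge0 ?enorm_ge0// sqr_enorm dotDD -!sqr_enorm.
by have := dot_le_enorm u v; lra.
Qed.

(** Coordinatewise the gap is [(u_i - v_i)^2]. The two factors 2 become those of [2 * A] and of
    [D1]. *)
Lemma sqr_enormD_le (R : realType) d (u v : 'rV[R]_d) :
  enorm (u + v) ^+ 2 <= 2 * enorm u ^+ 2 + 2 * enorm v ^+ 2.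
Proof.
rewrite !sqr_enorm /dot !mulr_sumr -big_split/=; apply: ler_sum => i _.
rewrite mxE -subr_ge0.
suff -> : 2 * (u ord0 i * u ord0 i) + 2 * (v ord0 i * v ord0 i) -
  (u ord0 i + v ord0 i) * (u ord0 i + v ord0 i) = (u ord0 i - v ord0 i) ^+ 2.
  exact: sqr_ge0.
by ring.
Qed.

Lemma enorm_dist_triangle (R : realType) d (v u w : 'rV[R]_d) :
  enorm (u - w) <= enorm (u - v) + enorm (v - w).
Proof. by rewrite -[u - w](subrKA v); exact: enormD. Qed.

Lemma enorm_continuous (R : realType) d : continuous (@enorm R d).
Proof.
have sqr_cont i : continuous (fun u : 'rV[R]_d => u ord0 i * u ord0 i : R).
  move=> u; have ui := @coord_continuous R 1 d ord0 i u.
  exact: (cvgM ui ui).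
have dot_cont : continuous (fun u : 'rV[R]_d => dot u u).
  apply: continuous_big => [|i _]; first exact: add_continuous.
  exact: sqr_cont.
by move=> u; apply: (continuous_comp (dot_cont u)); exact: sqrt_continuous.
Qed.

Lemma enorm_dist_continuous (R : realType) d (v : 'rV[R]_d) :
  continuous (fun u : 'rV[R]_d => enorm (u - v)).
Proof.
move=> u; apply: (@continuous_comp _ _ _ (fun u : 'rV[R]_d => u - v) _ u);
  last exact: enorm_continuous.
by apply: (@continuousB _ 'rV[R]_d); [exact: cvg_id | exact: cst_continuous].
Qed.

(** Bridge from sup-norm to Euclidean balls: a coordinate is at most the Euclidean norm, and
    conversely that norm is continuous. *)
Lemma nbhs_enormP (R : realType) d (v : 'rV[R]_d) (A : set 'rV[R]_d) :
  nbhs v A <->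
  exists2 e : R, 0 < e & forall u, enorm (u - v) < e -> A u.
Proof.
split=> [/nbhs_ballP[e e0 vA]|[e e0 vA]].
  exists e => // u uv; apply: vA; split=> // i j; rewrite ord1.
  rewrite /ball/= distrC; apply: le_lt_trans uv.
  by have := ler_coord_enorm (u - v) j; rewrite !mxE.
have ve : (\forall t \near enorm (v - v), t < e)%R.
  by apply: lt_nbhsl; rewrite subrr enorm0.
near=> u; apply: vA; near: u.
exact: (@enorm_dist_continuous _ _ v v _ ve).
Unshelve. all: by end_near. Qed.

(* [topology_theory] also exports a [proj]. *)
Local Notation proj := Defs.proj.

(** * Continuity of the nearest-point projection *)

Section UniqueProjection.
Context (R : realType) (d : nat) (S : set 'rV[R]_d).
Hypothesis proj_ok : forall x, exists! y, proj_set S x y.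

Lemma projP x : proj_set S x (proj S x).
Proof.
by have [y [xy _]] := proj_ok x; exact: (xgetPex 0 (ex_intro _ y xy)).
Qed.

Lemma proj_in x : S (proj S x).
Proof. by case: (projP x). Qed.

Lemma proj_min x y : S y -> enorm (proj S x - x) <= enorm (y - x).
Proof. by move=> Sy; have [_ /(_ y Sy)] := projP x; rewrite lee_fin. Qed.

Lemma proj_unique x y : S y -> enorm (y - x) <= enorm (proj S x - x) ->
  y = proj S x.
Proof.
move=> Sy xy; have [z [_ z_uniq]] := proj_ok x.
rewrite -(z_uniq _ (projP x)); apply/esym/z_uniq; split=> // t St.
by rewrite lee_fin; exact: le_trans (proj_min x St).
Qed.

(** A point of the closure is at distance zero from [S]; its nearest point attains this distance,
    hence equals it and puts it in [S]. *)
Lemma closed_of_proj : closed S.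
Proof.
move=> x Sx.
suff /eqP : enorm (proj S x - x) == 0.
  move=> px0; have -> : x = proj S x; last exact: proj_in.
  apply/rowP => i; apply/esym/eqP; rewrite -subr_eq0 -normr_le0 -px0.
  by have := ler_coord_enorm (proj S x - x) i; rewrite !mxE.
rewrite eq_le enorm_ge0 andbT; apply/ler_addgt0Pl => e e0; rewrite addr0.
have /Sx[y [Sy yx]] : nbhs x [set y | enorm (y - x) < e].
  by apply/nbhs_enormP; exists e.
exact: le_trans (proj_min x Sy) (ltW yx).
Qed.

(* On the compact set [K] of the points of [S] near [x] but [e]-away from
   [proj S x], the distance to [x] exceeds its minimum over [S] by a fixed
   amount, so [K] contains no [proj S x'] for [x'] close to [x]. *)
Lemma proj_continuous : continuous (proj S).
Proof.
move=> x A /nbhs_enormP[e e0 pA].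
pose r := enorm (proj S x - x).
pose K := [set y | [/\ S y, enorm (y - x) <= r + 1 &
                    e <= enorm (y - proj S x)]].
suff [m rm Km] : exists2 m, r < m & forall y, K y -> m <= enorm (y - x).
  (* If [|x' - x| < q], then [r + 2 |x' - x|] is below both [m] (the contradiction) and [r + 1]
     (membership in [K]). *)
  pose q := Num.min ((m - r) / 2) 2^-1.
  apply/nbhs_enormP; exists q.
    by rewrite lt_min divr_gt0 ?subr_gt0//= invr_gt0.
  move=> x'; rewrite lt_min => /andP[x'm x'1]; apply: pA.
  (* Go from [proj S x'] to [x] through [x'], replace [proj S x'] by the competitor [proj S x], and
     return to [x]. *)
  have x'r : enorm (proj S x' - x) <= r + 2 * enorm (x' - x).
    have := enorm_dist_triangle x' (proj S x') x.
    have := enorm_dist_triangle x (proj S x) x'.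
    by have := proj_min x' (proj_in x); rewrite (enorm_distC x x') -/r; lra.
  rewrite ltNge; apply/negP => ex'.
  have /Km : K (proj S x') by split; [exact: proj_in | lra | by []].
  lra.
have [K0|/set0P K_neq0] := eqVneq K set0.
  by exists (r + 1); [lra | rewrite K0].
have K_closed : closed K.
  have -> : K = S `&` ((fun y => enorm (y - x)) @^-1` [set t | t <= r + 1] `&`
      (fun y => enorm (y - proj S x)) @^-1` [set t | e <= t]).
    by apply/seteqP; split=> [y [? ? ?]|y [? [? ?]]]; split.
  apply: closedI; first exact: closed_of_proj.
  by apply: closedI; apply: preimage_closed => [y _|];
    [exact: enorm_dist_continuous | exact: closed_le
    |exact: enorm_dist_continuous | exact: closed_ge].
have K_compact : compact K.
  pose M := r + 1 + enorm x.
  apply: (subclosed_compact K_closed (rV_compact (fun _ : 'I_d =>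
    @segment_compact _ (- M) M))) => y [_ yx _] i /=.
  rewrite in_itv/= -ler_norml (le_trans (ler_coord_enorm y i))//.
  by have := enormD (y - x) x; rewrite subrK /M; lra.
have [|c] := EVT_min_rV K_neq0 K_compact (f := fun y => enorm (y - x)).
  by apply: continuous_subspaceT; exact: enorm_dist_continuous.
rewrite inE => Kc cmin; exists (enorm (c - x)); last first.
  by move=> y Ky; apply: cmin; rewrite inE.
(* A minimizer [c] at distance at most [r] would be [proj S x] by uniqueness, yet points of [K] stay
   [e] away from it. *)
rewrite ltNge; apply/negP => cr; case: Kc => Sc _.
by rewrite (proj_unique Sc cr) subrr enorm0; lra.
Qed.

End UniqueProjection.

(** * Freezing a variable independent of the past *)

Lemma ge0_integral_independent (R : realType) (dO d1 d2 : measure_display)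
    (Om : measurableType dO) (T1 : measurableType d1) (T2 : measurableType d2)
    (P : probability Om R) (X : {RV P >-> T1}) (Y : {RV P >-> T2})
    (h : T1 * T2 -> \bar R) :
  (forall A B, measurable A -> measurable B ->
    P (X @^-1` A `&` Y @^-1` B) = (P (X @^-1` A) * P (Y @^-1` B))%E) ->
  measurable_fun setT h -> (forall u, 0 <= h u)%E ->
  (\int[P]_w h (X w, Y w) =
   \int[P]_w \int[distribution P X]_z h (z, Y w))%E.
Proof.
move=> indep mh h0.
have mXY : measurable_fun setT (fun w => (X w, Y w)).
  by apply: measurable_fun_pair; exact: measurable_funPT.
pose XY : {RV P >-> (T1 * T2)%type} := mfun_Sub (mem_set mXY).
rewrite -[LHS](ge0_integral_distribution XY mh h0).
rewrite -(ge0_integral_distribution Y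
  (measurable_fun_fubini_tonelli_G (m1 := distribution P X) _ mh h0));
  last first.
  by move=> y; apply: integral_ge0.
(* After Tonelli it remains to identify the joint law with the product of the marginals; by
   independence they agree on rectangles. *)
rewrite -fubini_tonelli2//.
apply: eq_measure_integral => A mA _; apply/esym.
apply: product_measure_unique => // B C mB mC; exact: indep.
Qed.

(** Nonnegative [h] lets Tonelli apply directly; signed integrands are handled later through their
    positive and negative parts. *)
Lemma independent_condexp_ge0 (R : realType) (dO d1 d2 : measure_display)
    (Om : measurableType dO) (T1 : measurableType d1) (T2 : measurableType d2)
    (P : probability Om R) (D : probability T1 R) (G : set (set Om))
    (X : {RV P >-> T1}) (y : Om -> T2) (h : T1 * T2 -> \bar R) :
  <<s G >> `<=` measurable ->
  (forall B, measurable B -> <<s G >> (y @^-1` B)) ->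
  (forall B, measurable B -> P (X @^-1` B) = D B) ->
  (forall A B, <<s G >> A -> measurable B ->
    P (A `&` X @^-1` B) = (P A * P (X @^-1` B))%E) ->
  measurable_fun setT h -> (forall u, 0 <= h u)%E ->
  is_condexp_ge0 P <<s G >> (fun w => h (X w, y w))
    (fun w => \int[D]_z h (z, y w))%E.
Proof.
move=> mG Gy XD indep mh h0; split.
- move=> B mB; have := measurable_fun_fubini_tonelli_G (m1 := D) _ mh h0.
  by move=> /(_ measurableT B mB); rewrite setTI => /Gy.
- by move=> w; apply: integral_ge0.
move=> A GA.
(* Independence for [y] together with the indicator of [A] turns integrals
   over [A] into integrals over the whole space. *)
pose Y w := (y w, w \in A).
have GY B : measurable B -> <<s G >> (Y @^-1` B).
  move=> mB.
  (* Viewing [Om] with the smaller sigma-algebra makes the usual measurability rules prove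
     measurability with respect to [<<s G>>]. *)
  have mY : measurable_fun setT (Y : g_sigma_algebraType G -> T2 * bool).
    apply: measurable_fun_pair.
      by move=> _ C mC; rewrite setTI; exact: Gy.
    apply: (measurable_fun_bool true); rewrite setTI.
    suff -> : (fun w => w \in A) @^-1` [set true] = A by [].
    by apply/seteqP; split => w /=; [exact: set_mem | exact: mem_set].
  by have := mY measurableT B mB; rewrite setTI.
have mY : measurable_fun setT Y.
  by move=> _ B mB; rewrite setTI; apply: mG; exact: GY.
pose YRV : {RV P >-> (T2 * bool)%type} := mfun_Sub (mem_set mY).
pose h' (u : T1 * (T2 * bool)) := if u.2.2 then h (u.1, u.2.1) else 0%E.
have mh' : measurable_fun setT h'.
  apply: measurable_fun_if => //.
  - exact: (measurableT_comp measurable_snd measurable_snd).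
  - apply: measurable_funTS; apply: (measurableT_comp mh).
    apply: measurable_fun_pair; first exact: measurable_fst.
    exact: (measurableT_comp measurable_fst measurable_snd).
have h'0 u : (0 <= h' u)%E by rewrite /h'; case: ifP.
rewrite [LHS]integral_mkcond [RHS]integral_mkcond.
transitivity (\int[P]_w \int[distribution P X]_z h' (z, YRV w))%E.
  apply: eq_integral => w _; rewrite patchE /h' /=.
  case: (w \in A); last by rewrite integral0.
  by apply: eq_measure_integral => B mB _; exact/esym/XD.
rewrite -ge0_integral_independent// => B C mB mC.
by rewrite setIC indep 1?muleC//; exact: GY.
Qed.

(** * Borel measurability and elementary conditional expectations *)

Lemma continuous_borel_measurable (T U : ptopologicalType) (f : T -> U) :
  continuous f ->
  measurable_fun setT
    (f : g_sigma_algebraType (@open T) -> g_sigma_algebraType (@open U)).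
Proof.
move=> /continuousP cf.
apply: (@measurability _ _ (g_sigma_algebraType (@open T))
  (g_sigma_algebraType (@open U)) setT f (@open U)) => //.
by move=> _ [A oA <-]; rewrite setTI; apply: sub_sigma_algebra; exact: cf.
Qed.

Lemma continuous_borel_measurableR (R : realType) d (f : 'rV[R]_d -> R) :
  continuous f -> measurable_fun setT (f : borel_rV R d -> R).
Proof.
move=> /continuousP cf; apply: (measurability _ (RGenOpens.measurableE R)).
move=> _ [_ [a [b ->] <-]]; rewrite setTI; apply: sub_sigma_algebra.
exact/cf/interval_open.
Qed.

Lemma measurable_coord (R : realType) d i :
  measurable_fun setT (fun v : borel_rV R d => v ord0 i : R).
Proof. by apply: continuous_borel_measurableR; exact: coord_continuous. Qed.

Lemma measurable_sqr_enormB (R : realType) d (dT : measure_display)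
    (T : measurableType dT) (f g : T -> 'rV[R]_d) :
  (forall i, measurable_fun setT (fun t => f t ord0 i)) ->
  (forall i, measurable_fun setT (fun t => g t ord0 i)) ->
  measurable_fun setT (fun t => enorm (f t - g t) ^+ 2).
Proof.
move=> mf mg; under eq_fun do rewrite sqr_enorm /dot.
apply: measurable_sum => i; under eq_fun do rewrite !mxE.
by apply: measurable_funM; exact: measurable_funB.
Qed.

Lemma sub_measurable_comp (R : realType) (dO dT : measure_display)
    (Om : measurableType dO) (T : measurableType dT) (G : set (set Om))
    (y : Om -> T) (f : T -> \bar R) :
  (forall B, measurable B -> G (y @^-1` B)) -> measurable_fun setT f ->
  sub_measurable G (f \o y).
Proof.
by move=> Gy mf B mB; have := mf measurableT B mB; rewrite setTI => /Gy.
Qed.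

Lemma sub_measurable_cst (R : realType) (dO : measure_display)
    (Om : measurableType dO) (G : set (set Om)) (c : \bar R) :
  sub_measurable <<s G >> (fun=> c).
Proof.
move=> B _; rewrite preimage_cst; case: ifP => _; last exact: sigma_algebra0.
exact: (@measurableT _ (g_sigma_algebraType G)).
Qed.

(** The negative part vanishes, so [Yn = 0] serves, and [Y - 0] is meaningful even where [Y] is
    infinite. *)
Lemma is_condexp_ge0_nneg (R : realType) (dO : measure_display)
    (Om : measurableType dO) (P : probability Om R) (G : set (set Om))
    (X Y : Om -> \bar R) :
  measurable_fun setT X -> (forall w, 0 <= X w)%E ->
  is_condexp_ge0 P <<s G >> X Y -> is_condexp P <<s G >> X Y.
Proof.
move=> mX X0 XY; have [GY Y0 _] := XY; split=> //; exists Y, (cst 0%E); split.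
- suff -> : (X^\+)%E = X by [].
  by apply/funext => w; rewrite funeposE; apply/max_idPl.
- suff -> : (X^\-)%E = cst 0%E.
    by split=> [|w|A _]; [exact: sub_measurable_cst | exact: lexx |
      rewrite !integral0].
  by apply/funext => w; rewrite funenegE; apply/max_idPr; rewrite leeNl oppe0.
- by apply: aeW => w; split; [right; exact: ltry | rewrite sube0].
Qed.

(** * The sigma-algebra of the past *)

Section History.
Context (R : realType) (d : nat).
Context (dX : measure_display) (Xi : measurableType dX).
Context (dO : measure_display) (Om : measurableType dO) (P : probability Om R).
Context (xi : nat -> {RV P >-> Xi}) (x : nat -> {RV P >-> borel_rV R d}).

Lemma history_measurable k : history xi x k `<=` measurable.
Proof.
apply: smallest_sub; first exact: sigma_algebra_measurable.
by move=> A [[j _ [B mB <-]]|[j _ [B mB <-]]]; exact: measurable_funPT.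
Qed.

(** The history holds iterates up to index [k] included but samples only below [k]: [x k] is known
    while [xi k] is still fresh. *)
Lemma history_iterate k B : measurable B -> history xi x k (x k @^-1` B).
Proof.
move=> mB; apply: sub_sigma_algebra; right; exists k; first exact: leqnn.
by exists B => //; rewrite setTI.
Qed.

End History.

(** * Measurability of the mean operator and the squared error bound *)

Section SquaredError.
Context (R : realType) (d : nat).
Context (dX : measure_display) (Xi : measurableType dX) (D : probability Xi R).
Context (Fxi : Xi -> 'rV[R]_d -> 'rV[R]_d) (F : 'rV[R]_d -> 'rV[R]_d).
Hypothesis hF : stochastic_representation D Fxi F.

Definition sample_coord i (zx : Xi * borel_rV R d) : \bar R :=
  (Fxi zx.1 zx.2 ord0 i)%:E.

Lemma measurable_sample_coord i : measurable_fun setT (sample_coord i).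
Proof.
apply/measurable_EFinP.
exact: (measurableT_comp (@measurable_coord R d i) hF.1).
Qed.

(** The expectation is by definition the difference of these two integrals. This form gives both the
    measurability of [F] and the unbiasedness of the estimator. *)
Lemma mean_coordE x i : (F x ord0 i)%:E =
  (fubini_G D (sample_coord i)^\+ x - fubini_G D (sample_coord i)^\- x)%E.
Proof.
rewrite -(hF.2 x i).2 unlock integralE /fubini_G; congr (_ - _)%E.
  by apply: eq_integral => z _; rewrite !funeposE.
by apply: eq_integral => z _; rewrite !funenegE.
Qed.

(** [F] inherits measurability from the joint measurability of [Fxi], through Tonelli on each
    part. *)
Lemma measurable_mean_coord i :
  measurable_fun setT (fun x : borel_rV R d => F x ord0 i).
Proof.
apply/measurable_EFinP.
have -> : EFin \o (fun x : borel_rV R d => F x ord0 i) =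
    (fubini_G D (sample_coord i)^\+ \- fubini_G D (sample_coord i)^\-)%E.
  by apply/funext => x /=; exact: mean_coordE.
have mh := measurable_sample_coord i.
apply: emeasurable_funB.
  apply: measurable_fun_fubini_tonelli_G => [|u]; last exact: funepos_ge0.
  exact: measurable_funepos.
apply: measurable_fun_fubini_tonelli_G => [|u]; last exact: funeneg_ge0.
exact: measurable_funeneg.
Qed.

Lemma measurable_sqr_error (p : 'rV[R]_d -> 'rV[R]_d) :
  measurable_fun setT (p : borel_rV R d -> borel_rV R d) ->
  measurable_fun setT (fun zx : Xi * borel_rV R d =>
    enorm (Fxi zx.1 zx.2 - F (p zx.2)) ^+ 2).
Proof.
move=> mp; apply: measurable_sqr_enormB => i.
  by apply/measurable_EFinP; exact: (measurable_sample_coord i).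
apply: (measurableT_comp (measurable_mean_coord i)).
exact: (measurableT_comp mp measurable_snd).
Qed.

Lemma sqr_error_split (x y : 'rV[R]_d) :
  ('E_D[fun z => (enorm (Fxi z x - F y) ^+ 2)%R] <=
   2%:E * 'E_D[fun z => (enorm (Fxi z x - Fxi z y) ^+ 2)%R] +
   2%:E * 'E_D[fun z => (enorm (Fxi z y - F y) ^+ 2)%R])%E.
Proof.
have mFx (v : 'rV[R]_d) i : measurable_fun setT (fun z => Fxi z v ord0 i).
  apply/measurable_EFinP.
  exact: (measurable_fun_pair1 (v : borel_rV R d) (measurable_sample_coord i)).
have mE (f g : Xi -> 'rV[R]_d) :
    (forall i, measurable_fun setT (fun z => f z ord0 i)) ->
    (forall i, measurable_fun setT (fun z => g z ord0 i)) ->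
    measurable_fun setT (fun z => (enorm (f z - g z) ^+ 2)%:E).
  by move=> mf mg; apply/measurable_EFinP; exact: measurable_sqr_enormB.
have double (f : Xi -> R) : (forall z, 0 <= f z) ->
    measurable_fun setT (EFin \o f) ->
    (2%:E * \int[D]_z (f z)%:E = \int[D]_z (2 * f z)%:E)%E.
  by move=> f0 mf; rewrite -ge0_integralZl_EFin// => z _; rewrite lee_fin.
have double_ge0 (u : 'rV[R]_d) : 0 <= 2 * enorm u ^+ 2.
  by rewrite mulr_ge0// sqr_ge0.
rewrite unlock !double; do ?[by move=> z; exact: sqr_ge0]; do ?exact: mE.
rewrite -ge0_integralD//; do ?[by move=> z _; rewrite lee_fin];
  do ?[by apply/measurable_EFinP; apply: measurable_funM => //;
    apply/measurable_EFinP; exact: mE].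
apply: ge0_le_integral => //.
- by move=> z _; rewrite lee_fin sqr_ge0.
- exact: mE.
- by apply: emeasurable_funD; apply/measurable_EFinP;
    apply: measurable_funM => //; apply/measurable_EFinP; exact: mE.
- move=> z _; rewrite -EFinD lee_fin -[Fxi z x - F y](subrKA (Fxi z y)).
  exact: sqr_enormD_le.
Qed.

End SquaredError.

Theorem proposition3p2 (R : realType) (d : nat)
  (dX : measure_display) (Xi : measurableType dX) (D : probability Xi R)
  (Fxi : Xi -> 'rV[R]_d -> 'rV[R]_d) (F : 'rV[R]_d -> 'rV[R]_d)
  (hF : stochastic_representation D Fxi F)
  (r : 'rV[R]_d -> \bar R)
  (r_proper : proper_fun r) (r_lsc : lower_semicontinuous r)
  (r_convex : econvex r)
  (Xstar_neq0 : VI_solutions F r !=set0)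
  (proj_ok : forall x, exists! y, proj_set (VI_solutions F r) x y)
  (sigma_star_fin : (sigma_star2 D Fxi F (VI_solutions F r) < +oo)%E)
  (ell : R) (ell_ge0 : 0 <= ell)
  (cocoercive : expected_cocoercivity D Fxi F (VI_solutions F r) ell)
  (dO : measure_display) (Om : measurableType dO) (P : probability Om R)
  (gamma : R) (gamma_gt0 : 0 < gamma)
  (xi : nat -> {RV P >-> Xi}) (x : nat -> {RV P >-> borel_rV R d})
  (run : sgda_as D Fxi r gamma xi x) :
  key_parametric_assumption P (history xi x) F (VI_solutions F r)
    (fun k w => x k w) (fun k w => Fxi (xi k w) (x k w)) (fun _ _ => 0)
    ell 0 0 1 (2 * fine (sigma_star2 D Fxi F (VI_solutions F r))) 0.
Proof.
have [xiD indep _] := run.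
set S := VI_solutions F r.
(* A point of [S] keeps the supremum from being [-oo]; with finiteness, [fine] then returns its true
   value and not the default 0. *)
have sigma_ge0 : (0 <= sigma_star2 D Fxi F S)%E.
  have [y Sy] := Xstar_neq0.
  apply: le_trans (ereal_sup_ubound _); last by exists y.
  by apply: expectation_ge0 => z; exact: sqr_ge0.
have sigmaE : (fine (sigma_star2 D Fxi F S))%:E = sigma_star2 D Fxi F S.
  by rewrite fineK// ge0_fin_numE.
have mproj : measurable_fun setT (proj S : borel_rV R d -> borel_rV R d).
  by apply: continuous_borel_measurable; exact: proj_continuous.
split=> //.
- by split=> //; rewrite mulr_ge0// fine_ge0.
- by rewrite ltr01 lexx.
move=> k xs gs gap.
have Gk := @history_measurable _ _ _ _ _ _ _ xi x k.
have Gx := @history_iterate _ _ _ _ _ _ _ xi x k.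
have freeze h := independent_condexp_ge0 (h := h) Gk Gx (xiD k) (indep k).
have mxi_x : measurable_fun setT (fun w => (xi k w, x k w)).
  by apply: measurable_fun_pair; exact: measurable_funPT.
split.
- move=> i; have mh := measurable_sample_coord hF i.
  rewrite [X in is_condexp _ _ X](_ : _ =
    sample_coord Fxi i \o (fun w => (xi k w, x k w)))//.
  split; first exact: (measurableT_comp mh mxi_x).
    have /measurable_EFinP mF := measurable_mean_coord hF i.
    exact: (sub_measurable_comp Gx mF).
  exists (fun w => fubini_G D (sample_coord Fxi i)^\+%E (x k w)).
  exists (fun w => fubini_G D (sample_coord Fxi i)^\-%E (x k w)); split.
  + rewrite funepos_comp; apply: freeze => [|u]; last exact: funepos_ge0.
    exact: measurable_funepos.
  + rewrite funeneg_comp; apply: freeze => [|u]; last exact: funeneg_ge0.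
    exact: measurable_funeneg.
  + apply: aeW => w; split; last exact: mean_coordE hF _ _.
    left; have := integral_funepos_lt_pinfty measurableT (hF.2 (x k w) i).1.
    by congr (_ < _)%E; apply: eq_integral => z _; rewrite !funeposE.
- pose h (u : Xi * borel_rV R d) :=
    (enorm (Fxi u.1 u.2 - F (proj S u.2)) ^+ 2)%:E.
  have mh : measurable_fun setT h.
    by apply/measurable_EFinP; exact: (measurable_sqr_error hF mproj).
  have h0 u : (0 <= h u)%E by rewrite lee_fin sqr_ge0.
  exists (fun w => \int[D]_z h (z, x k w))%E.
    apply: is_condexp_ge0_nneg; last exact: freeze mh h0.
      exact: (measurableT_comp mh mxi_x).
    by move=> w; rewrite lee_fin sqr_ge0.
  apply: aeW => w.
  have := sqr_error_split hF (x k w) (xs w).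
  rewrite [in leLHS]unlock => /le_trans; apply.
  rewrite mul0r addr0 -mulrA [leRHS]EFinD [in leRHS]EFinM.
  rewrite [(2 * fine _)%:E]EFinM sigmaE; apply: leeD.
    by rewrite lee_pmul2l// cocoercive.
  (* The projection lies in [S], so its variance is one of the values under the supremum. *)
  rewrite lee_pmul2l//. apply: ereal_sup_ubound.
  by exists (xs w) => //; exact: (proj_in proj_ok).
(* With [sigma = 0], [C = D2 = 0] and [rho = 1], both sides are identically 0. *)
- exists (cst 0%E); last first.
    by apply: aeW => w; rewrite !(mulr0, mul0r, addr0) subrr mul0r addr0.
  rewrite [X in is_condexp _ _ X](_ : _ = cst 0%E); last first.
    by apply/funext => w /=; rewrite expr0n.
  apply: is_condexp_ge0_nneg; first exact: measurable_cst.
    by move=> w; exact: lexx.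
  by split=> [|w|//]; [exact: sub_measurable_cst | exact: lexx].
Qed.
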